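(* Let $(X,\tau)$ be an uncountable Polish space and $1\le\xi<\omega_1$. If $f:X\to\mathbb{R}$ is a Baire class $\xi$ function then $\alpha^*_\xi(f)\le\alpha_\xi(f)\le 2\alpha^*_\xi(f)$; hence $\alpha^*_\xi(f)\approx\alpha_\xi(f)$.
   Context: $\theta\lesssim\theta'$ means: for every $1\le\eta<\omega_1$, $\theta'\le\omega^\eta$ implies $\theta\le\omega^\eta$; $\approx$ means both directions; $2\theta$ denotes ordinal multiplication $2\cdot\theta$. A decreasing sequence $(F_\eta)_{\eta<\lambda}$ of subsets of $X$ is continuous if $F_0=X$, $F_\eta=\bigcap_{\theta<\eta}F_\theta$ for limit $\eta<\lambda$, and $\bigcap_{\eta<\lambda}F_\eta=\emptyset$ if $\lambda$ is a limit; $F_\eta=\emptyset$ for $\eta\ge\lambda$; its transfinite difference is $\bigcup_{\eta<\lambda,\ \eta\text{ even}}(F_\eta\setminus F_{\eta+1})$. For disjoint $\boldsymbol\Pi^0_{\xi+1}$ sets $A,B$, $\alpha_\xi(A,B)$ is the least $\lambda$ for which some continuous decreasing sequence $(F_\eta)_{\eta<\lambda}$ of $\boldsymbol\Pi^0_\xi$ sets has transfinite difference $H$ with $A\subseteq H\subseteq X\setminus B$; $\alpha_\xi(f)=\sup\{\alpha_\xi(\{f\le p\},\{f\ge q\}):p<q\text{ rational}\}$. Let $T_{f,\xi}$ be the set of Polish topologies $\tau'\supseteq\tau$ with $\tau'\subseteq\boldsymbol\Sigma^0_\xi(\tau)$ making $f$ Baire class $1$. $\alpha^*_\xi(f)=\min_{\tau'\in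 T_{f,\xi}}\alpha_{\tau'}(f)$, where $\alpha_{\tau'}(f)=\sup_{p<q\in\mathbb{Q}}\mathrm{rk}(D_{A,B})$ computed in $\tau'$: $A=\{f\le p\}$, $B=\{f\ge q\}$, $D_{A,B}(F)=\overline{F\cap A}\cap\overline{F\cap B}$ (closures in $\tau'$, $F$ $\tau'$-closed), iterates $D^{\eta+1}=D\circ D^\eta$ with intersections at limits, and $\mathrm{rk}(D)$ the least $\eta$ with $D^\eta(X)=\emptyset$. *)

(* Defs.v *)
From HB Require Import structures.
From mathcomp Require Import all_boot all_order all_algebra.
From mathcomp Require Import all_classical all_reals all_analysis.
Export numFieldNormedType.Exports.

Set Implicit Arguments.
Unset Strict Implicit.
Unset Printing Implicit Defensive.

Import Order.TTheory GRing.Theory Num.Theory.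

Local Open Scope classical_set_scope.
Local Open Scope ring_scope.

(* A countable ordinal is given by a tree built from 0, successor and suprema
   of sequences ([OSup g] is sup_n (g n), where [g] need not be increasing).
   Every countable ordinal has many representations, so ordinals are compared
   with the total preorder [ole] and identified by [oeq], never by Leibniz
   equality. *)
Inductive ord : Set :=
| OZ
| OS of ord
| OSup of (nat -> ord).

Inductive ole : ord -> ord -> Prop :=
| ole0 b : ole OZ b
| oleS a b : ole a b -> ole (OS a) (OS b)
| ole_sup a g n : ole a (g n) -> ole a (OSup g)
| osup_le g b : (forall n, ole (g n) b) -> ole (OSup g) b.

Definition olt (a b : ord) : Prop := ole (OS a) b.
Definition oeq (a b : ord) : Prop := ole a b /\ ole b a.

Definition oone : ord := OS OZ.
Definition otwo : ord := OS oone.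
Definition onat (n : nat) : ord := iter n OS OZ.
Definition omega : ord := OSup onat.

Definition limit_ord (a : ord) : Prop :=
  olt OZ a /\ forall b, olt b a -> olt (OS b) a.

Definition even_ord (a : ord) : Prop :=
  exists l n, (oeq l OZ \/ limit_ord l) /\ oeq a (iter n.*2 OS l).

Fixpoint oadd (a b : ord) : ord :=
  match b with
  | OZ => a
  | OS b' => OS (oadd a b')
  | OSup g => OSup (fun n => oadd a (g n))
  end.

(* [omul a b] is the order type of b copies of a: 2 * omega = omega. *)
Fixpoint omul (a b : ord) : ord :=
  match b with
  | OZ => OZ
  | OS b' => oadd (omul a b') a
  | OSup g => OSup (fun n => omul a (g n))
  end.

Fixpoint omega_pow (b : ord) : ord :=
  match b with
  | OZ => oone
  | OS b' => omul (omega_pow b') omega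
  | OSup g => OSup (fun n => omega_pow (g n))
  end.

(* The ordinals up to omega_1 inclusive, in which ranks take their values: a
   rank defined as a least countable ordinal is omega_1 when there is none. *)
Inductive xord : Set :=
| Ctbl of ord
| Omega1.

Definition xle (x y : xord) : Prop :=
  match x, y with
  | _, Omega1 => True
  | Omega1, Ctbl _ => False
  | Ctbl a, Ctbl b => ole a b
  end.

Definition xdouble (x : xord) : xord :=
  match x with
  | Ctbl a => Ctbl (omul otwo a)
  | Omega1 => Omega1
  end.

Definition xlesssim (x y : xord) : Prop :=
  forall eta, ole oone eta ->
    xle y (Ctbl (omega_pow eta)) -> xle x (Ctbl (omega_pow eta)).

Definition xapprox (x y : xord) : Prop := xlesssim x y /\ xlesssim y x.

Definition is_least (P : set ord) (a : ord) : Prop :=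
  P a /\ forall b, P b -> ole a b.

Definition least (P : set ord) : xord :=
  match pselect (exists a, is_least P a) with
  | left h => Ctbl (projT1 (cid h))
  | right _ => Omega1
  end.

Definition xsup (S : set xord) : xord :=
  least [set a | forall s, S s -> xle s (Ctbl a)].

Definition xmin (S : set xord) : xord :=
  least [set a | S (Ctbl a)].

Section BorelHierarchy.
Context {X : topologicalType}.

Inductive Sigma0 : ord -> set X -> Prop :=
| Sigma0_open xi A : oeq xi oone -> open A -> Sigma0 xi A
| Sigma0_bigcup xi (eta : nat -> ord) (A : nat -> set X) :
    (forall n, ole oone (eta n) /\ olt (eta n) xi) ->
    (forall n, Sigma0 (eta n) (~` A n)) ->
    Sigma0 xi (\bigcup_n A n).

Definition Pi0 (xi : ord) (A : set X) : Prop := Sigma0 xi (~` A).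

Inductive Baire_class (R : realType) : ord -> (X -> R) -> Prop :=
| Baire_class0 xi f : oeq xi OZ -> continuous f -> Baire_class xi f
| Baire_class_lim xi (eta : nat -> ord) (g : nat -> X -> R) f :
    (forall n, olt (eta n) xi) ->
    (forall n, Baire_class (eta n) (g n)) ->
    (forall x, g n x @[n --> \oo] --> f x) ->
    Baire_class xi f.

End BorelHierarchy.

Definition is_metric (R : realType) (T : Type) (d : T -> T -> R) : Prop :=
  [/\ forall x y, 0 <= d x y,
      forall x y, d x y = 0 <-> x = y,
      forall x y, d x y = d y x &
      forall x y z, d x z <= d x y + d y z].

Definition polish (R : realType) (X : topologicalType) : Prop :=
  (exists2 S : set X, countable S & dense S) /\
  exists d : X -> X -> R,
    [/\ is_metric d,
        forall (x : X) (A : set X),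
          nbhs x A <-> exists2 e, 0 < e & [set y | d x y < e] `<=` A &
        forall u : nat -> X,
          (forall e, 0 < e -> exists N, forall m n,
             (N <= m)%N -> (N <= n)%N -> d (u m) (u n) < e) ->
          exists x : X, u n @[n --> \oo] --> x].

Record topology (T : choiceType) := Topology {
  opens : set (set T);
  opens_setT : opens setT;
  opens_setI : setI_closed opens;
  opens_bigcup : forall (I : Type) (F : I -> set T),
    (forall i, opens (F i)) -> opens (\bigcup_i F i)
}.

(* The set T carrying the topology tau, whatever topology T itself has. *)
Definition with_topology (T : choiceType) (tau : topology T) : Type := T.
HB.instance Definition _ (T : choiceType) (tau : topology T) :=
  Choice.copy (with_topology tau) T.
HB.instance Definition _ (T : choiceType) (tau : topology T) :=
  isOpenTopological.Build (with_topology tau)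
    (opens_setT tau) (@opens_setI T tau) (@opens_bigcup T tau).

Section TransfiniteDifferences.
Context {X : topologicalType}.

(* A sequence (F_eta)_(eta < lam) is given by its extension by the empty set to
   all countable ordinals; being decreasing makes F independent of the
   representation of the index. *)
Definition continuous_decreasing (F : ord -> set X) (lam : ord) : Prop :=
  [/\ forall eta theta, ole eta theta -> F theta `<=` F eta,
      F OZ = setT,
      forall eta, olt eta lam -> limit_ord eta ->
        F eta = \bigcap_(theta in [set theta | olt theta eta]) F theta,
      limit_ord lam -> \bigcap_(eta in [set eta | olt eta lam]) F eta = set0 &
      forall eta, ole lam eta -> F eta = set0].

Definition transfinite_difference (F : ord -> set X) (lam : ord) : set X :=
  \bigcup_(eta in [set eta | olt eta lam /\ even_ord eta])
    (F eta `\` F (OS eta)).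

Definition alpha_sets (xi : ord) (A B : set X) : xord :=
  least [set lam | exists F : ord -> set X,
    [/\ continuous_decreasing F lam,
        forall eta, olt eta lam -> Pi0 xi (F eta),
        A `<=` transfinite_difference F lam &
        transfinite_difference F lam `<=` ~` B]].

Definition sublevel (R : realType) (f : X -> R) (p : rat) : set X :=
  [set x | f x <= ratr p].
Definition superlevel (R : realType) (f : X -> R) (q : rat) : set X :=
  [set x | ratr q <= f x].

Definition alpha_xi (R : realType) (xi : ord) (f : X -> R) : xord :=
  xsup [set s | exists p q : rat,
    p < q /\ s = alpha_sets xi (sublevel f p) (superlevel f q)].

Definition derivative_sep (A B F : set X) : set X :=
  closure (F `&` A) `&` closure (F `&` B).

(* For a decreasing derivative, the intersection over the terms of a sequence
   of ordinals is the iterate at the supremum of that sequence. *)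
Fixpoint iter_derivative (D : set X -> set X) (eta : ord) : set X :=
  match eta with
  | OZ => setT
  | OS eta' => D (iter_derivative D eta')
  | OSup g => \bigcap_n iter_derivative D (g n)
  end.

Definition rk (D : set X -> set X) : xord :=
  least [set eta | iter_derivative D eta = set0].

Definition alpha_top (R : realType) (f : X -> R) : xord :=
  xsup [set s | exists p q : rat,
    p < q /\ s = rk (derivative_sep (sublevel f p) (superlevel f q))].

End TransfiniteDifferences.

Definition T_set (R : realType) (X : topologicalType) (f : X -> R) (xi : ord)
    : set (topology X) :=
  [set tau' | [/\ polish R (with_topology tau'),
      forall U : set X, open U -> opens tau' U,
      forall U : set X, opens tau' U -> Sigma0 xi U &
      @Baire_class (with_topology tau') R oone f]].

Definition alpha_star (R : realType) (X : topologicalType) (xi : ord)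
    (f : X -> R) : xord :=
  xmin [set s | exists2 tau', T_set f xi tau' &
                  s = @alpha_top (with_topology tau') R f].

(* Main.v *)
(* The upper bound [alpha_xi <= 2 alpha_star] interleaves the derivatives
   [D^theta(X)] with the closures of [D^theta(X) `&` B], all of which are closed
   in a topology witnessing [alpha_star]. Conversely, given separating sequences
   of [Pi0 xi] sets for every pair p < q and [f = lim g_n] with [g_n] of lower
   class, refine the topology so that all the sets become closed and all the
   [g_n] continuous; an induction then gives [D^theta(X) `<=` F theta].

   The refinement is obtained from countably many functions [phi_i : X -> R] of
   low Borel class whose joint graph is closed in [X * R^nat]: the pullback of
   the topology of [X * R^nat] is then Polish. A set A = U_n A_n is made open and closed
   by "1 + the least n with x in A_n" (0 off A): a convergent sequence of values
   of this function is eventually constant, and its limit is the right one as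
   soon as this already holds for the functions attached to the A_n. *)

Require Import Defs.
From mathcomp Require Import all_boot all_order all_algebra.
From mathcomp Require Import all_classical all_reals all_analysis.
From mathcomp Require Import lra.

Set Implicit Arguments.
Unset Strict Implicit.
Unset Printing Implicit Defensive.

Import Order.TTheory GRing.Theory Num.Theory.

Local Open Scope classical_set_scope.
Local Open Scope ring_scope.

(** * Countable ordinals *)

(** A derivation of [ole (OSup g) b] may also end with [ole_sup], so an inversion is not enough. *)
Lemma osup_leE g b : ole (OSup g) b -> forall n, ole (g n) b.
Proof.
move e : (OSup g) => a ab; elim: ab g e => {a b} //.
- by move=> a g n _ IH g' e k; apply: ole_sup; exact: IH.
- by move=> g b gb _ g' [->].
Qed.

Lemma ole_refl a : ole a a.
Proof.
elim: a => [|a IH|g IH]; first exact: ole0.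
- exact: oleS.
- by apply: osup_le => n; apply: ole_sup (IH n).
Qed.
#[local] Hint Resolve ole_refl : core.

Lemma ole_trans b a c : ole a b -> ole b c -> ole a c.
Proof.
move=> ab; elim: ab c => {a b}.
- by move=> *; exact: ole0.
- move=> a b _ IH c; move e : (OS b) => b' bc.
  elim: bc e => {b' c} //.
  + by move=> b' c bc _ [bb']; rewrite -bb' in bc; apply: oleS; exact: IH.
  + by move=> b' g n _ IH' e; apply: ole_sup; exact: IH'.
- by move=> a g n _ IH c /osup_leE gc; exact: IH.
- by move=> g b _ IH c bc; apply: osup_le => n; exact: IH.
Qed.

Lemma oleS_inv a b : ole (OS a) (OS b) -> ole a b.
Proof. by move=> h; inversion h. Qed.

Lemma oltOZ a : ~ olt a OZ.
Proof. by move=> h; inversion h. Qed.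

Lemma olt_sup a g : olt a (OSup g) -> exists n, olt a (g n).
Proof. by move=> h; inversion h; exists n. Qed.

Lemma ole_sup_term g n : ole (g n) (OSup g).
Proof. exact: ole_sup (ole_refl _). Qed.

Lemma ole_succ a : ole a (OS a).
Proof.
elim: a => [|a IH|g IH]; first exact: ole0.
- exact: oleS.
- apply: osup_le => n; apply: ole_trans (IH n) _.
  by apply: oleS; exact: ole_sup_term.
Qed.

Lemma oltW a b : olt a b -> ole a b.
Proof. by apply: ole_trans; exact: ole_succ. Qed.

Lemma ole_lt_trans b a c : ole a b -> olt b c -> olt a c.
Proof. by move=> ab; apply: ole_trans; exact: oleS. Qed.

Lemma olt_le_trans b a c : olt a b -> ole b c -> olt a c.
Proof. exact: ole_trans. Qed.

Lemma olt_succ a : olt a (OS a). Proof. exact: ole_refl. Qed.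

Lemma oltS a b : olt a (OS b) -> ole a b.
Proof. exact: oleS_inv. Qed.

Lemma olt_irr a : ~ olt a a.
Proof.
elim: a => [|a IH|g IH]; first exact: oltOZ.
- by move=> /oltS.
- move=> /olt_sup[n gn]; apply: (IH n); apply: ole_lt_trans gn.
  exact: ole_sup_term.
Qed.

Lemma ole_or_lt a b : ole a b \/ olt b a.
Proof.
elim: a b => [|a IHa|g IH] b; first by left; exact: ole0.
- elim: b => [|b _|g IH].
  + by right; apply: oleS; exact: ole0.
  + by case: (IHa b) => h; [left|right]; exact: oleS.
  + have [[n h]|h] := pselect (exists n, ole (OS a) (g n)).
      by left; exact: ole_sup h.
    right; apply: oleS; apply: osup_le => n.
    case: (IH n) => [h'|/oltS//].
    by case: h; exists n.
- have [[n h]|h] := pselect (exists n, olt b (g n)).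
    by right; exact: ole_sup h.
  left; apply: osup_le => n; case: (IH n b) => // h'.
  by case: h; exists n.
Qed.

Lemma oltNle a b : olt a b -> ~ ole b a.
Proof. by move=> ab ba; apply: (@olt_irr a); exact: ole_trans ba. Qed.

Lemma oleNlt a b : ~ ole a b -> olt b a.
Proof. by case: (ole_or_lt a b). Qed.

Lemma oeq_or_lt a b : ole a b -> oeq a b \/ olt a b.
Proof. by move=> ab; case: (ole_or_lt b a) => h; [left|right]. Qed.

Lemma oeq_refl a : oeq a a. Proof. by split. Qed.

Lemma oeq_sym a b : oeq a b -> oeq b a. Proof. by case. Qed.

Lemma oeq_trans b a c : oeq a b -> oeq b c -> oeq a c.
Proof.
by move=> [ab ba] [bc cb]; split; [exact: ole_trans bc|exact: ole_trans ba].
Qed.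

Lemma olt_wf : well_founded olt.
Proof.
(* Stated for everything below [a], since an ordinal under a supremum is only known to lie under one
   of its terms. *)
suff H a b : ole b a -> Acc olt b by move=> a; exact: (H a).
elim: a b => [|a IH|g IH] b ba; constructor => c cb;
  have {cb} ca := olt_le_trans cb ba.
- by case: (oltOZ ca).
- by apply: IH; exact: oltS.
- by case: (olt_sup ca) => n /oltW/IH.
Qed.

Lemma is_least_exists (P : set ord) a : P a -> exists b, is_least P b.
Proof.
elim/(well_founded_ind olt_wf): a => a IH Pa.
have [[b [Pb ba]]|H] := pselect (exists b, P b /\ olt b a); first exact: IH Pb.
by exists a; split=> // b Pb; case: (ole_or_lt a b) => // ba; case: H; exists b.
Qed.

(** Makes the terms of a transfinite sequence a countable family; [e] may also take values outside
    the segment below [a]. *)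
Lemma enum_below a :
  exists e : nat -> ord, forall b, olt b a -> exists n, oeq b (e n).
Proof.
elim: a => [|a [e IH]|g /choice[e IH]].
- by exists (fun=> OZ) => b /oltOZ.
- exists (fun n => if n is k.+1 then e k else a) => b /oltS/oeq_or_lt[ba|/IH[n]].
    by exists 0%N.
  by exists n.+1.
- exists (fun k => if unpickle k is Some (n, m) then e n m else OZ).
  move=> b /olt_sup[n /IH[m bm]]; exists (pickle (n, m)).
  by rewrite pickleK.
Qed.

Lemma limit_ord_oeq a b : oeq a b -> limit_ord a -> limit_ord b.
Proof.
move=> [ab ba] [a0 aS]; split; first exact: olt_le_trans ab.
by move=> c cb; apply: olt_le_trans ab; apply: aS; exact: olt_le_trans ba.
Qed.

Lemma zero_succ_limit a : [\/ oeq a OZ, exists b, oeq a (OS b) | limit_ord a].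
Proof.
have [a0|a0] := ole_or_lt a OZ; first by constructor 1; split=> //; exact: ole0.
have [[b [ba bS]]|H] := pselect (exists b, olt b a /\ ole a (OS b)).
  by constructor 2; exists b.
constructor 3; split=> // b ba; apply: oleNlt => h.
by apply: H; exists b; split.
Qed.

Lemma limit_plus_nat a :
  exists l n, (oeq l OZ \/ limit_ord l) /\ oeq a (iter n OS l).
Proof.
elim/(well_founded_ind olt_wf): a => a IH.
have [a0|[b [ab ba]]|al] := zero_succ_limit a.
- by exists a, 0%N; split; [left|exact: oeq_refl].
- have [l [n [ll [h1 h2]]]] := IH b ba.
  exists l, n.+1; split=> //; split=> /=.
    by apply: ole_trans ab _; exact: oleS.
  by apply: ole_trans ba; exact: oleS.
- by exists a, 0%N; split; [right|exact: oeq_refl].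
Qed.

Lemma limit_iter_succ l n b : limit_ord l -> olt b l -> olt (iter n OS b) l.
Proof. by move=> [_ lS] bl; elim: n => //= n IH; exact: lS. Qed.

(** * Doubling and parity *)

Local Notation "'2*' a" := (omul otwo a) (at level 40, a at next level).

Lemma dbl_le a b : ole a b -> ole (2* a) (2* b).
Proof.
elim=> {a b} [b|a b _ IH|a g n _ IH|g b _ IH].
- exact: ole0.
- by do 2! apply: oleS.
- exact: ole_sup IH.
- exact: osup_le.
Qed.

Lemma dbl_lt a b : olt a b -> ole (OS (OS (2* a))) (2* b).
Proof. exact: dbl_le. Qed.

Lemma dbl_le_inv a b : ole (2* a) (2* b) -> ole a b.
Proof.
move=> h; case: (ole_or_lt a b) => // /dbl_lt h'.
by case: (@oltNle (2* b) (2* a)) => //; exact: oltW.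
Qed.

Lemma dbl_lt_inv a b : olt (2* a) (2* b) -> olt a b.
Proof. by move=> h; apply: oleNlt => /dbl_le; exact: oltNle. Qed.

Lemma dbl_ge a : ole a (2* a).
Proof.
elim: a => [|a IH|g IH]; first exact: ole0.
- by apply: oleS; apply: ole_trans IH _; exact: ole_succ.
- by apply: osup_le => n; apply: ole_sup (IH n).
Qed.

Lemma dbl_iter n a : 2* (iter n OS a) = iter n.*2 OS (2* a).
Proof. by elim: n => //= n ->. Qed.

Lemma iter_succ_le n a b : ole a b -> ole (iter n OS a) (iter n OS b).
Proof. by move=> ab; elim: n => //= n IH; exact: oleS. Qed.

Lemma lt_dbl b a : olt b (2* a) -> exists2 c, olt c a & ole b (OS (2* c)).
Proof.
elim: a => [/oltOZ//|a _|g IH].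
- by move=> /oltS h; exists a.
- move=> /olt_sup[n /IH[c cg h]]; exists c => //.
  by apply: olt_le_trans cg _; exact: ole_sup_term.
Qed.

(** Write [c] below [l] as [m + n] with [n] finite and [m] zero or a limit. By induction [2c] is at
    most [m + 2n], which stays below [l]. *)
Lemma dbl_limit l : limit_ord l -> oeq (2* l) l.
Proof.
elim/(well_founded_ind olt_wf): l => l IH ll; split; last exact: dbl_ge.
case: (ole_or_lt (2* l) l) => // /lt_dbl[c cl].
have [m [n [mm [h1 h2]]]] := limit_plus_nat c.
have ml : olt m l.
  apply: ole_lt_trans cl; apply: ole_trans h2.
  by elim: (n) => //= k hk; apply: ole_trans hk _; exact: ole_succ.
have m2 : ole (2* m) m.
  case: mm => [[m0 _]|mm]; last by case: (IH m ml mm).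
  by apply: ole_trans (dbl_le m0) _; exact: ole0.
have /dbl_le : ole c (iter n OS m) by [].
rewrite dbl_iter => h3 h4; exfalso; apply: (@olt_irr l).
apply: ole_lt_trans h4 _; case: (ll) => _; apply.
apply: ole_lt_trans h3 _; apply: (@ole_lt_trans (iter n.*2 OS m)).
  exact: iter_succ_le.
exact: limit_iter_succ.
Qed.

(** With the next lemma, the even ordinals are exactly the doubles: doubling turns [l + n] into
    [l + 2n] for [l] zero or a limit. *)
Lemma even_dbl a : even_ord (2* a).
Proof.
have [l [n [ll [h1 h2]]]] := limit_plus_nat a.
exists (2* l), n; split; last by rewrite -dbl_iter; split; exact: dbl_le.
case: ll => [[l0 _]|ll]; [left|right].
  by split; [exact: (dbl_le l0)|exact: ole0].
exact: limit_ord_oeq (oeq_sym (dbl_limit ll)) ll.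
Qed.

Lemma even_dblE a : even_ord a -> exists b, oeq a (2* b).
Proof.
move=> [l [n [ll h]]]; exists (iter n OS l); apply: oeq_trans h _.
rewrite dbl_iter.
have [h1 h2] : oeq (2* l) l.
  case: ll => [[l0 _]|/dbl_limit//]; split; last exact: dbl_ge.
  by apply: ole_trans (dbl_le l0) _; exact: ole0.
by split; exact: iter_succ_le.
Qed.

Lemma even_ord_oeq a b : oeq a b -> even_ord a -> even_ord b.
Proof.
move=> ab [l [n [ll h]]]; exists l, n; split=> //.
by apply: oeq_trans h; exact: oeq_sym.
Qed.

Lemma limit_dbl_inv a : limit_ord (2* a) -> limit_ord a.
Proof.
move=> [a0 aS]; split; first exact: dbl_lt_inv.
move=> b /dbl_lt h; apply: oleNlt => /dbl_le /= h'.
by apply: (oltNle _ h'); exact: aS.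
Qed.

(** * Addition and powers of omega *)

Lemma oadd_ge a b : ole a (oadd a b).
Proof.
elim: b => [|b IH|g IH] //=; first by apply: ole_trans IH _; exact: ole_succ.
exact: ole_sup (IH 0%N).
Qed.

Lemma oadd_le a b c : ole b c -> ole (oadd a b) (oadd a c).
Proof.
elim=> {b c} [b|b c _ IH|b g n _ IH|g b _ IH] /=.
- exact: oadd_ge.
- exact: oleS.
- exact: ole_sup IH.
- exact: osup_le.
Qed.

Lemma omega_pow_ge1 b : ole oone (omega_pow b).
Proof.
elim: b => [|b IH|g IH] //=; last exact: ole_sup (IH 0%N).
apply: (@ole_sup _ _ 1%N); apply: ole_trans IH _ => /=.
by elim: (omega_pow b) => [|a IH|g IH] /=;
  [exact: ole0|exact: oleS|apply: osup_le => n; exact: ole_sup (IH n)].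
Qed.

Lemma omega_pow_succ_limit b : limit_ord (omega_pow (OS b)).
Proof.
split; first exact: (omega_pow_ge1 (OS b)).
move=> c /olt_sup[n h]; apply: (@ole_sup _ _ n.+1).
apply: ole_trans (oleS h) _ => /=.
exact: (oadd_le (omul (omega_pow b) (onat n)) (omega_pow_ge1 b)).
Qed.

Lemma omega_pow_le1 b : ole b OZ -> ole (omega_pow b) oone.
Proof.
elim: b => [//|b _ /oltOZ//|g IH h]; apply: osup_le => n; apply: IH.
exact: osup_leE h n.
Qed.

Lemma dbl_omega_pow eta : ole oone eta -> ole (2* (omega_pow eta)) (omega_pow eta).
Proof.
elim: eta => [/oltOZ//|b _ _|g IH].
  by case: (dbl_limit (omega_pow_succ_limit b)).
move=> /olt_sup[n n1]; apply: osup_le => m.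
(* A zero exponent gives 1, which doubling does not preserve; it is bounded through the term [n],
   whose exponent is positive. *)
have [m0|m1] := ole_or_lt (g m) OZ; last exact: ole_sup (IH m m1).
apply: (@ole_sup _ _ n); apply: ole_trans (IH n n1); apply: dbl_le.
exact: ole_trans (omega_pow_le1 m0) (omega_pow_ge1 _).
Qed.

(** * Least elements and suprema in [xord] *)

Lemma least_le (P : set ord) a : P a -> xle (least P) (Ctbl a).
Proof.
move=> Pa; rewrite /least; case: pselect => [h|[]]; last exact: is_least_exists Pa.
by case: (projT2 (cid h)) => _; exact.
Qed.

Lemma least_Ctbl (P : set ord) a : least P = Ctbl a -> is_least P a.
Proof. by rewrite /least; case: pselect => // h [<-]; exact: projT2 (cid h). Qed.

Lemma xle_trans y x z : xle x y -> xle y z -> xle x z.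
Proof. by case: x y z => [a|] [b|] [c|] //=; exact: ole_trans. Qed.

Lemma xle_Ctbl x a : xle x (Ctbl a) -> exists2 b, x = Ctbl b & ole b a.
Proof. by case: x => // b h; exists b. Qed.

Lemma xsup_le (S : set xord) a :
  (forall s, S s -> xle s (Ctbl a)) -> xle (xsup S) (Ctbl a).
Proof. exact: least_le. Qed.

Lemma xsup_ub (S : set xord) a s :
  xle (xsup S) (Ctbl a) -> S s -> xle s (Ctbl a).
Proof.
move=> /xle_Ctbl[b /least_Ctbl[h _] ba] /h h'; exact: xle_trans h' _.
Qed.

(** * Derivatives and transfinite differences *)

Section Separation.
Context {X : topologicalType}.
Implicit Types A B F G : set X.

Lemma derivative_sep_sub A B F G :
  F `<=` G -> derivative_sep A B F `<=` derivative_sep A B G.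
Proof.
by move=> FG x [xA xB]; split; [apply: closureS xA|apply: closureS xB];
  exact: setSI.
Qed.

(** The constructors of [ole] mirror the clauses of the iteration. In particular the iterate does
    not depend on the representation of its index. *)
Lemma iter_derivative_anti A B a b : ole a b ->
  iter_derivative (derivative_sep A B) b `<=`
  iter_derivative (derivative_sep A B) a.
Proof.
elim=> {a b} [b|a b _ IH|a g n _ IH|g b _ IH] //=.
- exact: derivative_sep_sub.
- by move=> x /(_ n I)/IH.
- by move=> x xb n _; exact: IH.
Qed.

Lemma closed_iter_derivative A B a :
  closed (iter_derivative (derivative_sep A B) a).
Proof.
elim: a => [|a IH|g IH] /=.
- exact: closedT.
- by apply: closedI; exact: closed_closure.
- exact: closed_bigI.
Qed.

(** A limit can only be represented by an [OSup], each term of which is either below [l] or again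
    represents [l]. *)
Lemma iter_derivative_limit A B l x : limit_ord l ->
  (forall b, olt b l -> iter_derivative (derivative_sep A B) b x) ->
  iter_derivative (derivative_sep A B) l x.
Proof.
elim: l => [//|a _ [_ /(_ a (olt_succ a))/olt_irr//]|g IH ll H n _].
have [gl|gl] := oeq_or_lt (ole_sup_term g n); last exact: H.
apply: IH; first exact: limit_ord_oeq (oeq_sym gl) ll.
by move=> b bg; apply: H; apply: olt_le_trans bg (ole_sup_term _ _).
Qed.

(** The least index whose iterate misses [x] is neither zero nor a limit, hence a successor. *)
Lemma iter_derivative_exit A B mu x :
  iter_derivative (derivative_sep A B) mu = set0 ->
  exists b, [/\ olt b mu, iter_derivative (derivative_sep A B) b x &
    ~ iter_derivative (derivative_sep A B) (OS b) x].
Proof.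
set D := derivative_sep A B => mu0.
have [|a [ax amin]] :=
  @is_least_exists [set a | ~ iter_derivative D a x] mu; first by rewrite /= mu0 => -[].
have Hlt b : olt b a -> iter_derivative D b x.
  by move=> ba; apply: contrapT => /amin; exact: oltNle.
have [a0|[b [ab ba]]|al] := zero_succ_limit a.
- by case: ax; apply: (iter_derivative_anti a0.1).
- exists b; split.
  + by apply: olt_le_trans (amin mu _) => //=; rewrite mu0 => -[].
  + exact: Hlt.
  + by move=> h; apply: ax; apply: iter_derivative_anti h.
- by case: ax; exact: iter_derivative_limit.
Qed.

(** At [2 theta] this is [D^theta(X)], at [2 theta + 1] the closure of its trace on [B].
    Intersecting all terms up to [eta] gives one formula for every index. *)
Definition interleave A B (eta : ord) : set X := [set x | forall theta,
  (ole (2* theta) eta -> iter_derivative (derivative_sep A B) theta x) /\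
  (olt (2* theta) eta ->
     closure (iter_derivative (derivative_sep A B) theta `&` B) x)].

Lemma interleave_anti A B a b : ole a b ->
  interleave A B b `<=` interleave A B a.
Proof.
move=> ab x xb theta; have [h1 h2] := xb theta; split=> h.
- by apply: h1; exact: ole_trans ab.
- by apply: h2; exact: olt_le_trans ab.
Qed.

Lemma closed_interleave A B a : closed (interleave A B a).
Proof.
have -> : interleave A B a =
    \bigcap_(theta in [set theta | ole (2* theta) a])
       iter_derivative (derivative_sep A B) theta `&`
    \bigcap_(theta in [set theta | olt (2* theta) a])
       closure (iter_derivative (derivative_sep A B) theta `&` B).
  apply/seteqP; split=> [x h|x [h1 h2] theta].
    by split=> theta; have [] := h theta.
  by split; [exact: h1|exact: h2].
apply: closedI; apply: closed_bigI => theta _; last exact: closed_closure.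
exact: closed_iter_derivative.
Qed.

Lemma interleave_limit A B a : limit_ord a ->
  interleave A B a = \bigcap_(b in [set b | olt b a]) interleave A B b.
Proof.
move=> al; apply/seteqP; split=> [x xa b ba|x H theta].
  by apply: interleave_anti xa; exact: oltW.
have H1 eta : olt (2* eta) a -> iter_derivative (derivative_sep A B) eta x.
  by move=> h; have [+ _] := H _ h eta; exact.
split=> h; last first.
  by have [_ +] := H _ (al.2 _ h) theta; apply; exact: olt_succ.
(* If [2* theta] is the limit [a] itself, then [theta] is a limit too and the iteration is
   continuous there. *)
have [e|/H1//] := oeq_or_lt h.
apply: iter_derivative_limit.
  by apply: limit_dbl_inv; exact: limit_ord_oeq (oeq_sym e) al.
move=> b /dbl_lt hb; apply: H1; apply: olt_le_trans h.
by apply: ole_trans hb; exact: ole_succ.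
Qed.

Lemma interleave_empty A B mu a :
  iter_derivative (derivative_sep A B) mu = set0 -> ole (2* mu) a ->
  interleave A B a = set0.
Proof.
move=> mu0 mua; rewrite -subset0 => x /(_ mu)[/(_ mua)].
by rewrite mu0.
Qed.

Lemma interleave_continuous A B mu :
  iter_derivative (derivative_sep A B) mu = set0 ->
  continuous_decreasing (interleave A B) (2* mu).
Proof.
move=> mu0; split.
- by move=> *; exact: interleave_anti.
- rewrite -subTset => x _ theta; split=> [h|/oltOZ//].
  apply: (iter_derivative_anti (b := OZ)) => //.
  exact: ole_trans (dbl_ge _) h.
- by move=> eta _; exact: interleave_limit.
- by move=> h; rewrite -interleave_limit// (interleave_empty mu0).
- by move=> eta; exact: interleave_empty.
Qed.

(** Let [x] in [A] leave the iterates between [b] and [OS b]. It is in the closure of the trace of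
    [A] on the [b]-th iterate, so not in that of [B], and lies in the layer at [2* b]. *)
Lemma interleave_difference_sup A B mu :
  iter_derivative (derivative_sep A B) mu = set0 ->
  A `<=` transfinite_difference (interleave A B) (2* mu).
Proof.
move=> mu0 x Ax; have [b [bmu xb xSb]] := iter_derivative_exit x mu0.
exists (2* b).
  split; last exact: even_dbl.
  by apply: ole_trans (dbl_lt bmu); exact: ole_succ.
split=> [theta|/(_ b)[_ /(_ (olt_succ _)) xB]].
  split=> [/dbl_le_inv h|/dbl_lt_inv h].
    exact: iter_derivative_anti xb.
  by have [] := iter_derivative_anti h xb.
by apply: xSb; split=> //; apply: subset_closure; split.
Qed.

(** A point of [B] in an even term [D^b(X)] lies in its trace on [B], hence survives to the next
    term. *)
Lemma interleave_difference_sub A B mu :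
  transfinite_difference (interleave A B) mu `<=` ~` B.
Proof.
move=> x [eta [_ /even_dblE[b [h1 h2]]] [xeta xSeta]] Bx; apply: xSeta => theta.
split=> [/oeq_or_lt[[h' h]|/oltS h]|/oltS h].
(* [2* theta] cannot be the successor of [2* b], since the next double is two steps away. *)
- have /dbl_lt bt : olt b theta.
    by apply: dbl_lt_inv; apply: ole_lt_trans h2 h.
  case: (oltNle (olt_succ (OS (2* b)))); apply: ole_trans bt _.
  by apply: ole_trans h' _; exact: oleS.
- by have [+ _] := xeta theta; exact.
- by apply: subset_closure; split=> //; have [+ _] := xeta theta; exact.
Qed.

(** Suppose [x] is in the iterate at [OS b] but not in the closed set [F (OS b)]. Near [x] the
    [b]-th iterate, hence [F b], has points of both [A] and [B] outside [F (OS b)]; so the layer at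
    [b] meets both sets, which is impossible. *)
Lemma iter_derivative_sub_difference A B (F : ord -> set X) lam :
  continuous_decreasing F lam -> (forall a, closed (F a)) ->
  A `<=` transfinite_difference F lam ->
  transfinite_difference F lam `<=` ~` B ->
  forall a, iter_derivative (derivative_sep A B) a `<=` F a.
Proof.
move=> [Fanti F0 Flim Fend Fempty] Fcl AH HB a.
have Feq b c : oeq b c -> F b = F c.
  by move=> [bc cb]; apply/seteqP; split; exact: Fanti.
(* Each layer [F a `\` F (OS a)] misses [A] or [B], according to the parity
   of [a]. *)
have layer b : olt b lam ->
    (F b `\` F (OS b)) `&` A = set0 \/ (F b `\` F (OS b)) `&` B = set0.
  move=> bl; have [be|bo] := pselect (even_ord b); [right|left].
    by rewrite -subset0 => x [xb Bx]; apply: HB Bx; exists b.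
  rewrite -subset0 => x [[xb xSb]] /AH[c [_ ce] [xc xSc]]; apply: bo.
  apply: even_ord_oeq ce; split.
    by case: (ole_or_lt c b) => // bc; case: xSb; exact: Fanti bc _ xc.
  by case: (ole_or_lt b c) => // bc; case: xSc; exact: Fanti bc _ xb.
elim/(well_founded_ind olt_wf): a => a IH x xa.
have xF b : olt b a -> F b x.
  by move=> ba; apply: (IH b ba); apply: iter_derivative_anti xa; exact: oltW.
have [a0|[b ab]|al] := zero_succ_limit a.
- by rewrite (Feq _ _ a0) F0.
- have ba : olt b a by case: ab.
  rewrite (Feq _ _ ab); apply: contrapT => xSb.
  have [|bl] := ole_or_lt lam b; first by move=> /Fempty; rewrite predeqE => /(_ x)[/(_ (xF _ ba))].
  have [cA cB] : derivative_sep A B (iter_derivative (derivative_sep A B) b) x.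
    exact: (iter_derivative_anti ab.2 xa).
  have nx : nbhs x (~` F (OS b)).
    by apply: open_nbhs_nbhs; split=> //; exact: closed_openC.
  case: (layer b bl) => h.
  + have [y [[yb Ay] yS]] := cA _ nx.
    by rewrite -[False]/(set0 y) -h; split=> //; split=> //; exact: IH yb.
  + have [y [[yb By] yS]] := cB _ nx.
    by rewrite -[False]/(set0 y) -h; split=> //; split=> //; exact: IH yb.
(* Below [lam] continuity of [F] suffices. A limit from [lam] on cannot occur, as the terms below it
   would have a common point. *)
- have [la|al'] := ole_or_lt lam a; last by rewrite Flim.
  exfalso; have [e|/xF] := oeq_or_lt la; last by rewrite Fempty.
  rewrite -[False]/(set0 x) -(Fend (limit_ord_oeq (oeq_sym e) al)) => b bl.
  by apply: xF; exact: olt_le_trans la.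
Qed.

End Separation.

(** * The Borel hierarchy of a metrizable space *)

Lemma Sigma0_inv (X : topologicalType) xi (A : set X) : Sigma0 xi A ->
  (oeq xi oone /\ open A) \/
  (olt oone xi /\ exists (eta : nat -> ord) (B : nat -> set X),
    [/\ forall n, ole oone (eta n) /\ olt (eta n) xi,
        forall n, Sigma0 (eta n) (~` B n) & A = \bigcup_n B n]).
Proof.
case=> {}xi; first by left.
move=> eta B heta hB; right; split; last by exists eta, B.
by have [h1 h2] := heta 0%N; exact: ole_lt_trans h2.
Qed.

Lemma Sigma0_one (X : topologicalType) xi (A : set X) :
  oeq xi oone -> Sigma0 xi A -> open A.
Proof.
move=> [xi1 _] /Sigma0_inv[[]//|[h _]].
by case: (oltNle h).
Qed.

Definition metrizes (R : realType) (X : topologicalType) (d : X -> X -> R) :=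
  forall x A, nbhs x A <-> exists2 e, 0 < e & [set y | d x y < e] `<=` A.

Section Borel.
Context {R : realType} {X : topologicalType} (d : X -> X -> R).
Hypotheses (dm : is_metric d) (dX : metrizes d).
Implicit Types A B : set X.

Lemma metric_openP A :
  open A <-> forall x, A x -> exists2 e, 0 < e & [set y | d x y < e] `<=` A.
Proof.
rewrite openE; split=> H x Ax.
  by apply/dX; exact: H.
by apply/dX; exact: H.
Qed.

Lemma metric_open_ball x (e : R) : open [set y | d x y < e].
Proof.
case: dm => _ _ _ dtri; apply/metric_openP => y /= xy.
exists (e - d x y); first by rewrite subr_gt0.
move=> z /= yz; apply: le_lt_trans (dtri _ y _) _.
by rewrite -ltrBrDl.
Qed.

(** [F n] collects the points whose ball of radius [1/(n+1)] stays inside [A]. This lifts open sets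
    to all higher levels. *)
Lemma open_Fsigma A : open A ->
  exists2 F : nat -> set X, forall n, open (~` F n) & A = \bigcup_n F n.
Proof.
case: (dm) => d0 dxx dC dtri /metric_openP Ao.
exists (fun n => [set x | [set y | d x y < n.+1%:R^-1] `<=` A]) => [n|].
  apply/metric_openP => x /= /existsNP[y /not_implyP[/= xy Ay]].
  exists (n.+1%:R^-1 - d x y); first by rewrite subr_gt0.
  move=> z /= xz H; apply: Ay; apply: H => /=.
  by apply: le_lt_trans (dtri _ x _) _; rewrite (dC z) -ltrBrDr.
apply/seteqP; split=> [x /Ao[e e0 eA]|x [n _]]; last first.
  by apply; rewrite /= (dxx x x).2// invr_gt0.
have [n ne] := ltr_add_invr (y := 0) e0; exists n => // y /= xy; apply: eA => /=.
by apply: lt_trans xy _; rewrite add0r in ne.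
Qed.

(** * Monotonicity and closure properties of the classes *)

Lemma open_Sigma0 xi A : ole oone xi -> open A -> Sigma0 xi A.
Proof.
move=> xi1 oA; have [xi1'|xi1'] := ole_or_lt xi oone; first exact: Sigma0_open.
have [F Fo ->] := open_Fsigma oA.
apply: (@Sigma0_bigcup _ _ (fun=> oone)) => // n.
by apply: Sigma0_open => //; exact: oeq_refl.
Qed.

Lemma Sigma0_ge1 xi A : Sigma0 xi A -> ole oone xi.
Proof. by move=> /Sigma0_inv[[[]]|[/oltW]]. Qed.

Lemma Sigma0_le xi xi' A : ole xi xi' -> Sigma0 xi A -> Sigma0 xi' A.
Proof.
move=> h A0; have := Sigma0_ge1 A0; move: A0.
case/Sigma0_inv=> [[_ oA] xi1|[_ [eta [B [heta hB ->]]]] _].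
  by apply: open_Sigma0 => //; exact: ole_trans h.
apply: (@Sigma0_bigcup _ _ eta) => // n; have [h1 h2] := heta n.
by split=> //; exact: olt_le_trans h.
Qed.

Lemma Pi0_Sigma0 xi xi' A : olt xi xi' -> Sigma0 xi (~` A) -> Sigma0 xi' A.
Proof.
move=> h A0; have -> : A = \bigcup_(n in [set: nat]) A by rewrite bigcup_const//; exists 0%N.
by apply: (@Sigma0_bigcup _ _ (fun=> xi)) => // n; split=> //; exact: Sigma0_ge1 A0.
Qed.

Lemma Sigma0_bigcup_nat xi (A : nat -> set X) :
  (forall n, Sigma0 xi (A n)) -> Sigma0 xi (\bigcup_n A n).
Proof.
move=> hA; have xi1 := Sigma0_ge1 (hA 0%N).
have [xi1'|xi1'] := ole_or_lt xi oone.
  by apply: open_Sigma0 => //; apply: bigcup_open => n _; exact: Sigma0_one (hA n).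
have /choice[h hP] n : exists h : (nat -> ord) * (nat -> set X),
    [/\ forall m, ole oone (h.1 m) /\ olt (h.1 m) xi,
        forall m, Sigma0 (h.1 m) (~` h.2 m) & A n = \bigcup_m h.2 m].
  case/Sigma0_inv: (hA n) => [[[h _] _]|[_ [eta [B [h1 h2 h3]]]]].
    by case: (oltNle xi1').
  by exists (eta, B).
(* Numbers that code no pair fall back on [(0, 0)], which only repeats a set of the union. *)
pose k i := odflt (0%N, 0%N) (unpickle i) : nat * nat.
have -> : \bigcup_n A n = \bigcup_i (h (k i).1).2 (k i).2.
  apply/seteqP; split=> [x [n _]|x [i _ xi']].
    have [_ _ ->] := hP n => -[m _ xm]; exists (pickle (n, m)) => //.
    by rewrite /k pickleK.
  exists (k i).1 => //; have [_ _ ->] := hP (k i).1.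
  by exists (k i).2.
apply: (@Sigma0_bigcup _ _ (fun i => (h (k i).1).1 (k i).2)) => i;
  by have [h1 h2 _] := hP (k i).1.
Qed.

Lemma Sigma0_setU xi A B : Sigma0 xi A -> Sigma0 xi B -> Sigma0 xi (A `|` B).
Proof.
move=> hA hB; have -> : A `|` B = \bigcup_n (if n is 0%N then A else B).
  apply/seteqP; split=> [x [Ax|Bx]|x [[|n] _ h]].
  - by exists 0%N.
  - by exists 1%N.
  - by left.
  - by right.
by apply: Sigma0_bigcup_nat; case.
Qed.

Lemma Sigma0_bigcup_countable (I : countType) xi (P : set I) (A : I -> set X) :
  ole oone xi ->
  (forall i, P i -> Sigma0 xi (A i)) -> Sigma0 xi (\bigcup_(i in P) A i).
Proof.
move=> xi1 hA.
have -> : \bigcup_(i in P) A i =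
    \bigcup_n (if unpickle n is Some i then [set x | P i /\ A i x] else set0).
  apply/seteqP; split=> [x [i Pi xi']|x [n _]].
    by exists (pickle i) => //; rewrite pickleK.
  by case: unpickle => // i [Pi xi']; exists i.
apply: Sigma0_bigcup_nat => n; case: unpickle => [i|]; last first.
  by apply: open_Sigma0 => //; exact: open0.
have [Pi|Pi] := pselect (P i).
  by rewrite (_ : mkset _ = A i); [exact: hA|apply/seteqP; split=> // x []].
rewrite (_ : mkset _ = set0); last by rewrite -subset0 => x [].
by apply: open_Sigma0 => //; exact: open0.
Qed.

Lemma Sigma0_setI xi A B : Sigma0 xi A -> Sigma0 xi B -> Sigma0 xi (A `&` B).
Proof.
move=> hA hB; have xi1 := Sigma0_ge1 hA.
have [xi1'|xi1'] := ole_or_lt xi oone.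
  apply: open_Sigma0 => //; apply: openI;
  by apply: Sigma0_one; last by [exact: hA|exact: hB].
case/Sigma0_inv: hA => [[[h _] _]|[_ [eta [F [h1 h2 ->]]]]].
  by case: (oltNle xi1').
case/Sigma0_inv: hB => [[[h _] _]|[_ [eta' [F' [h1' h2' ->]]]]].
  by case: (oltNle xi1').
rewrite setI_bigcupl.
apply: Sigma0_bigcup_nat => n; rewrite setI_bigcupr.
apply: Sigma0_bigcup_nat => m.
(* The complement of the intersection of two pieces is the union of their complements, both at the
   larger of the two levels. *)
have [h|/oltW h] := ole_or_lt (eta n) (eta' m).
  apply: (@Pi0_Sigma0 (eta' m)); first by case: (h1' m).
  by rewrite setCI; apply: Sigma0_setU => //; exact: Sigma0_le h _.
apply: (@Pi0_Sigma0 (eta n)); first by case: (h1 n).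
by rewrite setCI; apply: Sigma0_setU => //; exact: Sigma0_le h _.
Qed.

Lemma Sigma0_bigcap_lt xi n (A : nat -> set X) : ole oone xi ->
  (forall i, (i < n)%N -> Sigma0 xi (A i)) ->
  Sigma0 xi [set x | forall i, (i < n)%N -> A i x].
Proof.
move=> xi1; elim: n => [|n IH] hA.
  by rewrite (_ : mkset _ = setT); [apply: open_Sigma0 => //; exact: openT|
    rewrite -subTset].
rewrite (_ : mkset _ = [set x | forall i, (i < n)%N -> A i x] `&` A n).
  by apply: Sigma0_setI; [apply: IH => i /leqW; exact: hA|exact: hA].
apply/seteqP; split=> [x h|x [h1 h2] i /=].
  by split=> [i /leqW|]; exact: h.
by rewrite ltnS leq_eqVlt => /predU1P[->//|]; exact: h1.
Qed.

(** For a limit, [f x] is in [U] iff for some [m] all but finitely many [g n x] lie in the closed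
    set [F m] of points deep inside [U]. For fixed [m] and [N] the negation is a countable union at
    level [xi], whence the level [OS xi]. *)
Lemma Baire_class_Sigma0 xi (f : X -> R) : Baire_class xi f ->
  forall U, open U -> Sigma0 (OS xi) (f @^-1` U).
Proof.
elim=> {xi f} [xi f _ fc U oU|xi eta g f heta _ IH gf U oU].
  apply: open_Sigma0; first by apply: oleS; exact: ole0.
  by move/continuousP: fc; exact.
pose F m := [set y : R | ball y m.+1%:R^-1 `<=` U].
have Fcl m : open (~` F m).
  rewrite openE => y /= /existsNP[z /not_implyP[yz Uz]].
  exists (m.+1%:R^-1 - `|y - z|) => /=; first by rewrite subr_gt0.
  move=> w /= yw H; apply: Uz; apply: H.
  rewrite /ball /= (le_lt_trans (ler_distD y _ _))// distrC.
  by rewrite -ltrBrDr.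
have FU m : F m `<=` U by move=> y; apply; apply: ballxx; rewrite invr_gt0.
have -> : f @^-1` U = \bigcup_m \bigcup_N ~` \bigcup_n (g (N + n)%N @^-1` (~` F m)).
  apply/seteqP; split=> [x /= Ufx|x [m _ [N _]] H].
    have /nbhs_ballP[e /= e0 eU] : nbhs (f x) U by apply: open_nbhs_nbhs.
    have [m me] := ltr_add_invr (y := 0) (divr_gt0 e0 (ltr0n R 2)).
    have /cvgrPdist_lt/(_ _ (divr_gt0 e0 (ltr0n R 2)))[N _ HN] := gf x.
    exists m => //; exists N => // -[n _]; apply => z /= gz; apply: eU => /=.
    apply: le_lt_trans (ler_distD (g (N + n)%N x) _ _) _.
    rewrite (splitr e) ltrD//; first by apply: HN; exact: leq_addr.
    by apply: lt_trans gz _; rewrite add0r in me.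
  apply: (FU m); apply: (@closed_cvg _ _ _ eventually_filter (g^~ x) (F m)) (gf x).
    by rewrite -openC.
  exists N => // n /= Nn; apply: contrapT => h; apply: H; exists (n - N)%N => //.
  by rewrite /= subnKC.
apply: Sigma0_bigcup_nat => m; apply: Sigma0_bigcup_nat => N.
apply: (@Pi0_Sigma0 xi) => //; rewrite setCK.
apply: Sigma0_bigcup_nat => n; apply: Sigma0_le (heta _) _; exact: IH.
Qed.

End Borel.

(** * Encoding Borel sets by functions with closed graph *)

(** Sequential closedness of the graph of the joint map given by all of [Phi]; a single function of
    [Phi] may fail this on its own. *)
Definition closed_graph (R : realType) (X : topologicalType)
    (Phi : set (X -> R)) :=
  forall (u : nat -> X) (x : X), u n @[n --> \oo] --> x ->
    (forall phi, Phi phi -> cvg (phi (u n) @[n --> \oo])) ->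
    forall phi, Phi phi -> phi (u n) @[n --> \oo] --> phi x.

(** With [M] one more than the limit, values above [M] are too far from the limit, which leaves only
    zeros. *)
Lemma cvg0_of_gap (R : realType) (v : nat -> R) : cvg (v n @[n --> \oo]) ->
  (forall M, \forall n \near \oo, v n = 0 \/ M < v n) ->
  v n @[n --> \oo] --> 0.
Proof.
move=> vc H; set l := lim (v n @[n --> \oo]).
apply: (@cvg_trans _ (0 @[n --> \oo])); last exact: cvg_cst.
apply: near_eq_cvg; near=> n.
have [//|h] : v n = 0 \/ l + 1 < v n by near: n; exact: H.
have : `|l - v n| < 1 by near: n; move/cvgrPdist_lt : vc; apply.
rewrite distrC ltr_norml => /andP[_]; rewrite ltrBlDl => h'.
by move: (lt_trans h h'); rewrite ltxx.
Unshelve. all: by end_near. Qed.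

Section Encoding.
Context {R : realType} {X : topologicalType} (d : X -> X -> R).
Hypotheses (dm : is_metric d) (dX : metrizes d).
Implicit Types A B : set X.

Lemma metric_cvgP (u : nat -> X) x : u n @[n --> \oo] --> x <->
  forall e, 0 < e -> \forall n \near \oo, d x (u n) < e.
Proof.
split=> [ux e e0|H A /dX[e e0 eA]].
  by apply: (ux [set y | d x y < e]); apply/dX; exists e.
by apply: filterS (H e e0) => n; exact: eA.
Qed.

(** [delta] is the distance to the complement of [A] capped at 1, written as a supremum of radii so
    that an empty complement is allowed. It is 1-Lipschitz. *)
Lemma open_depth A : open A -> exists delta : X -> R,
  [/\ forall x, 0 <= delta x <= 1, forall x, (delta x = 0) <-> ~ A x &
      continuous delta].
Proof.
case: (dm) => d0 dxx dC dtri /(metric_openP dX) Ao.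
pose S x := [set e : R | 0 <= e <= 1 /\ [set y | d x y < e] `<=` A].
have S0 x : S x 0.
  by split=> [|y /=]; [rewrite lexx ler01|rewrite ltNge d0].
have Sub x : has_ubound (S x) by exists 1 => e [/andP[]].
have leS x e : S x e -> e <= sup (S x) by move=> h; apply: ub_le_sup.
have Sle x c : (forall e, S x e -> e <= c) -> sup (S x) <= c.
  by move=> h; apply: ge_sup => //; exists 0.
have lip x y : sup (S x) <= sup (S y) + d x y.
  apply: Sle => e [/andP[e0 e1] eA].
  have [h|h] := leP e (d x y).
    by apply: le_trans h _; rewrite lerDr; exact: leS.
  rewrite -lerBlDr; apply: leS; split=> [|z /= yz].
    by rewrite subr_ge0 (ltW h)/= lerBlDr (le_trans e1)// lerDl.
  by apply: eA => /=; apply: le_lt_trans (dtri _ y _) _; rewrite -ltrBrDl.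
exists (fun x => sup (S x)); split=> [x|x|x].
- by rewrite leS//=; apply: Sle => e [/andP[]].
- split=> [Sx0 Ax|Ax].
    have [e e0 eA] := Ao x Ax.
    have : S x (Num.min e 1).
      split; first by rewrite le_min (ltW e0) ler01 ge_min lexx orbT.
      by move=> y /=; rewrite lt_min => /andP[/eA].
    by move/leS; rewrite Sx0 leNgt lt_min e0 ltr01.
  apply/eqP; rewrite eq_le leS// andbT; apply: Sle => e [_ eA].
  by rewrite leNgt; apply/negP => e0; apply: Ax; apply: eA; rewrite /= (dxx x x).2.
- apply/cvgrPdist_lt => e e0; apply/dX; exists e => // y /= xy.
  have h1 := lip x y; have h2 := lip y x; rewrite dC in h2.
  apply: le_lt_trans xy; rewrite ler_norml; apply/andP; split; lra.
Qed.

(** The inverse depth is continuous on [A] and unbounded along points of [A] tending to the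
    complement, so convergent values there are eventually zero. A preimage is an open part of [A]
    together with the complement of [A] or nothing. *)
Lemma open_encoding A : open A -> exists phi : X -> R,
  [/\ closed_graph [set phi], forall x, phi x = 0 \/ 1 <= phi x,
      A = [set x | phi x != 0] &
      forall U zeta, open U -> olt oone zeta -> Sigma0 zeta (phi @^-1` U)].
Proof.
move=> oA; have [delta [d01 dA dc]] := open_depth oA.
(* [0^-1 = 0], so that [phi] vanishes exactly off [A]. *)
pose phi x := (delta x)^-1.
have cA x : A x -> {for x, continuous phi}.
  move=> Ax; apply: cvgV; last exact: dc.
  by apply/eqP => /dA.
have phi0 x : ~ A x -> phi x = 0 by move=> /dA h; rewrite /phi h invr0.
have phi1 x : A x -> 1 <= phi x.
  move=> Ax; have /andP[h0 h1] := d01 x.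
  have h : 0 < delta x by rewrite lt_neqAle h0 andbT eq_sym; apply/eqP => /dA.
  by rewrite /phi invr_ge1// unitfE gt_eqF.
exists phi; split.
- move=> u x ux /(_ phi erefl) uc _ ->.
  have [Ax|Ax] := pselect (A x).
    exact: (cvg_comp _ _ ux (cA x Ax)).
  rewrite (phi0 _ Ax); apply: cvg0_of_gap => // M.
  have M0 : 0 < (Num.max M 1)^-1 by rewrite invr_gt0 lt_max ltr01 orbT.
  have /cvgrPdist_lt/(_ _ M0) := cvg_comp _ _ ux (dc x).
  apply: filterS => n; rewrite (dA x).2// sub0r normrN => h.
  have [Au|/phi0] := pselect (A (u n)); last by left.
  right; have /andP[h0 h1] := d01 (u n).
  have hd : 0 < delta (u n).
    by rewrite lt_neqAle h0 andbT eq_sym; apply/eqP => /dA.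
  rewrite /= ger0_norm// in h.
  have : Num.max M 1 < phi (u n).
    by rewrite /phi -[ltLHS]invrK ltf_pV2// ?posrE// invr_gt0 lt_max ltr01 orbT.
  by rewrite gt_max => /andP[].
- by move=> x; have [/phi1|/phi0] := pselect (A x); [right|left].
- apply/seteqP; split=> [x /phi1 h|x /=]; first by rewrite /= gt_eqF// (lt_le_trans ltr01).
  by move=> /eqP h; apply: contrapT => /phi0.
- move=> U zeta oU z1.
  have -> : phi @^-1` U = (A `&` phi @^-1` U) `|` (~` A `&` [set x | U 0]).
    apply/seteqP; split=> [x /= Ux|x [[]//|[Ax U0]]]; last by rewrite /= phi0.
    have [Ax|Ax] := pselect (A x); first by left.
    by right; split=> //=; rewrite -(phi0 _ Ax).
  have oz := oltW z1.
  apply: (Sigma0_setU dm dX).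
    apply: (open_Sigma0 dm dX) => //; rewrite openE => x [Ax Ux].
    apply: filterI; first by apply: open_nbhs_nbhs.
    by apply: (cA x Ax); apply: open_nbhs_nbhs.
  have [U0|U0] := pselect (U 0).
    rewrite (_ : _ `&` _ = ~` A); last by apply/seteqP; split=> // y [].
    apply: (Pi0_Sigma0 z1); rewrite setCK.
    exact: (open_Sigma0 dm dX).
  rewrite (_ : _ `&` _ = set0); last by rewrite -subset0 => y [].
  by apply: (open_Sigma0 dm dX) => //; exact: open0.
Qed.

Lemma closed_graph_bigcup (I : Type) (Phi : I -> set (X -> R)) :
  (forall i, closed_graph (Phi i)) -> closed_graph (\bigcup_i Phi i).
Proof.
move=> H u x ux uc phi [i _ Phii].
by apply: (H i) => // psi Psii; apply: uc; exists i.
Qed.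

Lemma first_index (A : nat -> set X) : exists psi : X -> R, forall x,
  (psi x = 0 /\ forall n, ~ A n x) \/
  exists n, [/\ psi x = n.+1%:R, A n x & forall m, (m < n)%N -> ~ A m x].
Proof.
suff /choice[psi psiP] : forall x, exists v : R, (v = 0 /\ forall n, ~ A n x) \/
    exists n, [/\ v = n.+1%:R, A n x & forall m, (m < n)%N -> ~ A m x].
  by exists psi.
move=> x; have [[n An]|H] := pselect (exists n, A n x); last first.
  by exists 0; left; split=> // n An; apply: H; exists n.
have ex : exists n, `[< A n x >] by exists n; exact/asboolP.
case: (ex_minnP ex) => m /asboolP Am mmin; exists m.+1%:R; right; exists m.
split=> // k km Ak; have := mmin k (asboolT Ak).
by rewrite leqNgt km.
Qed.

Lemma near_forall_lt (P : nat -> nat -> Prop) n :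
  (forall m, (m < n)%N -> \forall k \near \oo, P m k) ->
  \forall k \near \oo, forall m, (m < n)%N -> P m k.
Proof.
elim: n => [|n IH] H; first exact: nearW.
have h1 := IH (fun m mn => H m (leqW mn)); have h2 := H n (ltnSn n).
apply: filterS2 h1 h2 => k h1 h2 m; rewrite ltnS leq_eqVlt => /predU1P[->//|].
exact: h1.
Qed.

(** A zero and a nonzero value are at least 1 apart, so values closer than 1 to the limit agree with
    it on vanishing. *)
Lemma gap_decides (phi : X -> R) (u : nat -> X) x :
  (forall y, phi y = 0 \/ 1 <= phi y) -> phi (u n) @[n --> \oo] --> phi x ->
  \forall n \near \oo, phi (u n) = 0 <-> phi x = 0.
Proof.
move=> phi01 /cvgrPdist_lt/(_ _ ltr01).
case: (phi01 x) => [->|px]; apply: filterS => n.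
  rewrite sub0r normrN => h; split=> // _; case: (phi01 (u n)) => // h'.
  by move: h; rewrite ger0_norm ?ltNge ?h'// (le_trans ler01).
move=> h; split=> h'; exfalso; last by move: px; rewrite h' leNgt ltr01.
by move: h; rewrite h' subr0 ger0_norm ?ltNge ?px// (le_trans ler01).
Qed.

(** [Phi] adds to [phi] the auxiliary functions that make the joint graph closed. Preimages are
    controlled strictly above [xi], where both [A] and its complement are available. *)
Definition encodes xi A (Phi : set (X -> R)) (phi : X -> R) :=
  [/\ countable Phi, closed_graph Phi, Phi phi,
      (forall x, phi x = 0 \/ 1 <= phi x) /\ A = [set x | phi x != 0] &
      forall psi U zeta, Phi psi -> open U -> olt xi zeta ->
        Sigma0 zeta (psi @^-1` U)].

Lemma encodes_zero xi A Phi phi x : encodes xi (~` A) Phi phi ->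
  A x <-> phi x = 0.
Proof.
move=> [_ _ _ [_ e] _]; have -> : A x <-> ~ (~` A) x by split=> [Ax|/contrapT].
by rewrite e /=; split=> [/negP/negPn/eqP|->]; rewrite ?eqxx.
Qed.

(** The functions obtained by induction eventually decide membership in each [A n] along [u]. The
    first index is then eventually constant if [x] is in the union, and otherwise zero or
    arbitrarily large. *)
Lemma Sigma0_encoding xi A : Sigma0 xi A ->
  exists Phi phi, encodes xi A Phi phi.
Proof.
elim=> {xi A} [xi A [_ x1] /open_encoding[phi [h1 h2 h3 h4]]|xi eta A heta hA IH].
  exists [set phi], phi; split=> // psi U zeta -> oU z1.
  by apply: h4 => //; exact: ole_lt_trans z1.
have {}IH n : exists P, encodes (eta n) (~` A n) P.1 P.2.
  by have [Phi [phi ?]] := IH n; exists (Phi, phi).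
have {IH}[P HP] := choice IH.
have [psi psiP] := first_index A.
have psi0 x : psi x = 0 <-> ~ (\bigcup_n A n) x.
  case: (psiP x) => [[-> H]|[n [-> An _]]].
    by split=> // _ [n _]; exact: H.
  by split=> [/eqP|[]]; [rewrite pnatr_eq0|exists n].
exists ([set psi] `|` \bigcup_n (P n).1), psi; split.
- rewrite -bigcup2E; apply: bigcup_countable => // -[|[|n]] _ //=.
  by apply: bigcup_countable => // n _; case: (HP n).
- move=> u x ux uc.
  have uP n phi : (P n).1 phi -> phi (u k) @[k --> \oo] --> phi x.
    case: (HP n) => _ cg _ _ _; apply: cg => // chi Pchi.
    by apply: uc; right; exists n.
  have decide n : \forall k \near \oo, A n (u k) <-> A n x.
    have [_ _ PP [P01 _] _] := HP n.
    apply: filterS (gap_decides P01 (uP n _ PP)) => k.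
    by rewrite !(encodes_zero _ (HP n)).
  move=> phi [->|[n _ Pn]]; last exact: uP Pn.
  case: (psiP x) => [[-> Ax]|[n [-> An Am]]].
    apply: cvg0_of_gap; first by apply: uc; left.
    (* Eventually [u k] avoids every [A n] with [n <= truncn M], so a nonzero first index exceeds
       [M]. *)
    move=> M; have := @near_forall_lt (fun n k => A n (u k) <-> A n x)
      (Num.truncn M).+1 (fun n _ => decide n).
    apply: filterS => k H; case: (psiP (u k)) => [[]|[n [-> An _]]]; [by left|right].
    have [nM|Mn] := ltnP n (Num.truncn M).+1.
      by case: (Ax n); apply/H.
    apply: lt_le_trans (truncnS_gt M) _; rewrite ler_nat.
    exact: leq_trans Mn _.
  apply: (@cvg_trans _ (n.+1%:R @[_ --> \oo])); last exact: cvg_cst.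
  apply: near_eq_cvg.
  have := @near_forall_lt (fun n k => A n (u k) <-> A n x) n.+1 (fun n _ => decide n).
  apply: filterS => k H; case: (psiP (u k)) => [[_ /(_ n)[]]|[m [-> Amu mmin]]].
    by apply/H.
  case: (ltngtP m n) => [mn|nm|->//].
    by case: (Am m mn); apply/H => //; exact: ltnW.
  by case: (mmin n nm); apply/H.
- by left.
- split=> [x|].
    by case: (psiP x) => [[->]|[n [-> _ _]]]; [left|right; rewrite ler1n].
  apply/seteqP; split=> x; first by move=> h; apply/eqP => /psi0.
  by move=> /= /eqP h; apply: contrapT => /psi0.
- have Sx : Sigma0 xi (\bigcup_n A n) by exact: Defs.Sigma0_bigcup heta hA.
  move=> phi U zeta [->|[n _ Pphi]] oU xz; last first.
    have [_ _ _ _] := HP n; apply => //.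
    by apply: olt_le_trans (oltW xz); case: (heta n).
  have zeta1 := ole_trans (Sigma0_ge1 Sx) (oltW xz).
  have -> : psi @^-1` U =
      (\bigcup_(n in [set n | U n.+1%:R])
         (A n `&` [set x | forall m, (m < n)%N -> ~ A m x])) `|`
      (~` (\bigcup_n A n) `&` [set x | U 0]).
    apply/seteqP; split=> x /=.
      case: (psiP x) => [[-> H] U0|[n [-> An Am]] Un]; last by left; exists n.
      by right; split=> // -[n _]; exact: H.
    case=> [[n Un [An Am]]|[/psi0 -> //]].
    case: (psiP x) => [[_ /(_ n)]//|[k [-> Ak kmin]]].
    case: (ltngtP k n) => [kn|nk|->//]; first by case: (Am k kn).
    by case: (kmin n nk).
  have Alt n : Sigma0 zeta (A n).
    apply: (Pi0_Sigma0 _ (hA n)).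
    by apply: olt_le_trans (oltW xz); case: (heta n).
  have ANlt n : Sigma0 zeta (~` A n).
    apply: (Sigma0_le dm dX _ (hA n)); apply: ole_trans (oltW xz).
    by apply: oltW; case: (heta n).
  apply: (Sigma0_setU dm dX).
    apply: (Sigma0_bigcup_countable dm dX) => // n _.
    apply: (Sigma0_setI dm dX) => //.
    exact: (Sigma0_bigcap_lt dm dX (A := fun m => ~` A m)).
  have [U0|U0] := pselect (U 0).
    rewrite (_ : _ `&` _ = ~` \bigcup_n A n); last by apply/seteqP; split=> // y [].
    by apply: (Pi0_Sigma0 xz); rewrite setCK.
  rewrite (_ : _ `&` _ = set0); last by rewrite -subset0 => y [].
  by apply: (open_Sigma0 dm dX) => //; exact: open0.
Qed.

(* [A] is open in the coarsest topology refining that of [X] for which the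
   functions in [Phi] are continuous, stated with sequences. *)
Definition seq_open_in (Phi : set (X -> R)) A :=
  forall (u : nat -> X) x, A x -> u n @[n --> \oo] --> x ->
    (forall phi, Phi phi -> phi (u n) @[n --> \oo] --> phi x) ->
    \forall n \near \oo, A (u n).

(** A union of pieces [C n] of lower level is opened by encoding the complement of each piece, which
    keeps preimages at level [xi]; encoding the union itself would only control the levels above
    [xi]. *)
Lemma Sigma0_opening (I : countType) xi (A : I -> set X) :
  (forall i, Sigma0 xi (A i)) -> exists Phi : set (X -> R),
  [/\ countable Phi, closed_graph Phi,
      forall phi U, Phi phi -> open U -> Sigma0 xi (phi @^-1` U) &
      forall i, seq_open_in Phi (A i)].
Proof.
move=> hA.
suff {hA}H B : Sigma0 xi B -> exists Phi : set (X -> R),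
    [/\ countable Phi, closed_graph Phi,
      forall phi U, Phi phi -> open U -> Sigma0 xi (phi @^-1` U) &
      seq_open_in Phi B].
  have /choice[Phi PhiP] i := H _ (hA i).
  exists (\bigcup_i Phi i); split.
  - by apply: bigcup_countable => // i _; case: (PhiP i).
  - by apply: closed_graph_bigcup => i; case: (PhiP i).
  - by move=> phi U [i _]; have [_ _ + _] := PhiP i; exact.
  - move=> i u x Ax ux H'; have [_ _ _ op] := PhiP i; apply: (op u x) => //.
    by move=> phi Pphi; apply: H'; exists i.
case/Sigma0_inv=> [[_ oB]|[xi1 [eta [C [heta hC ->]]]]].
  exists set0; split=> //.
  by move=> u x Bx ux _; apply: ux; apply: open_nbhs_nbhs.
have {}hC n : exists P, encodes (eta n) (~` C n) P.1 P.2.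
  by have [Phi [phi ?]] := Sigma0_encoding (hC n); exists (Phi, phi).
have {hC}[P HP] := choice hC.
exists (\bigcup_n (P n).1); split.
- by apply: bigcup_countable => // n _; case: (HP n).
- by apply: closed_graph_bigcup => n; case: (HP n).
- by move=> phi U [n _ Pphi] oU; have [_ _ _ _] := HP n; apply => //; case: (heta n).
- move=> u x [n _ Cx] ux H; have [_ _ PP [P01 _] _] := HP n.
  have /(gap_decides P01) : (P n).2 (u k) @[k --> \oo] --> (P n).2 x.
    by apply: H; exists n.
  apply: filterS => k e; exists n => //; apply/(encodes_zero _ (HP n))/e.
  exact/(encodes_zero _ (HP n)).
Qed.

End Encoding.

(** * Pulling back the topology along a closed graph *)

Lemma countable_enum (T : Type) (x0 : T) (A : set T) : countable A ->
  exists e : nat -> T, (forall x, A x -> exists n, e n = x) /\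
    forall n, A (e n) \/ e n = x0.
Proof.
move=> /countable_injP[h hinj].
suff /choice[e eP] : forall n, exists y,
    (A y \/ y = x0) /\ forall x, A x -> h x = n -> y = x.
  exists e; split=> [x Ax|n]; last by case: (eP n).
  by exists (h x); have [_] := eP (h x); exact.
move=> n; have [[y [Ay hy]]|H] := pselect (exists y, A y /\ h y = n).
  exists y; split=> [|x Ax hx]; first by left.
  by apply: hinj; rewrite ?inE// hy.
by exists x0; split=> [|x Ax hx]; [right|case: H; exists x].
Qed.

Section Refinement.
Context {R : realType} {X : topologicalType} (d : X -> X -> R).
Hypotheses (dm : is_metric d) (dX : metrizes d).
Hypothesis dcomplete : forall u : nat -> X,
  (forall e, 0 < e -> exists N, forall m n,
     (N <= m)%N -> (N <= n)%N -> d (u m) (u n) < e) ->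
  exists x : X, u n @[n --> \oo] --> x.
Variables (x0 : X) (e : nat -> X -> R).
Hypothesis e_closed : forall (u : nat -> X) (x : X), u n @[n --> \oo] --> x ->
  (forall i, cvg (e i (u n) @[n --> \oo])) ->
  forall i, e i (u n) @[n --> \oo] --> e i x.

Definition coord_dist i x y : R :=
  if i is j.+1 then `|e j x - e j y| else d x y.

(** The product metric of [X] and countably many lines, pulled back along the graph. Truncating
    coordinate [i] at [1/(i+1)] leaves finitely many coordinates to control for a given
    precision. *)
Definition graph_dist x y : R :=
  sup (range (fun i => Num.min i.+1%:R^-1 (coord_dist i x y))).

Lemma coord_dist_ge0 i x y : 0 <= coord_dist i x y.
Proof. by case: dm => d0 _ _ _; case: i => [|i] /=; [exact: d0|exact: normr_ge0]. Qed.

Lemma coord_distxx i x : coord_dist i x x = 0.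
Proof. by case: dm => _ dxx _ _; case: i => [|i] /=; [apply/dxx|rewrite subrr normr0]. Qed.

Lemma coord_distC i x y : coord_dist i x y = coord_dist i y x.
Proof. by case: dm => _ _ dC _; case: i => [|i] /=; [exact: dC|exact: distrC]. Qed.

Lemma coord_dist_tri i x y z :
  coord_dist i x z <= coord_dist i x y + coord_dist i y z.
Proof. by case: dm => _ _ _ dt; case: i => [|i] /=; [exact: dt|exact: ler_distD]. Qed.

Lemma graph_dist_ge i x y :
  Num.min i.+1%:R^-1 (coord_dist i x y) <= graph_dist x y.
Proof.
apply: ub_le_sup; last by exists i.
by exists 1 => _ [j _ <-]; rewrite ge_min invf_le1// ler1n.
Qed.

Lemma graph_dist_le c x y :
  (forall i, Num.min i.+1%:R^-1 (coord_dist i x y) <= c) -> graph_dist x y <= c.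
Proof.
by move=> H; apply: ge_sup => [|_ [i _ <-]]; first by eexists; exists 0%N.
Qed.

Lemma graph_dist_metric : is_metric graph_dist.
Proof.
case: (dm) => d0 dxx dC dt; split.
- move=> x y; apply: le_trans (graph_dist_ge 0 x y).
  by rewrite le_min coord_dist_ge0 invr_ge0 ler0n.
- move=> x y; split=> [h|<-].
    apply/(dxx x y)/eqP; rewrite eq_le d0 andbT.
    by have := graph_dist_ge 0 x y; rewrite h /= ge_min invr1 ler10.
  apply/le_anti/andP; split.
    by apply: graph_dist_le => i; rewrite coord_distxx ge_min lexx orbT.
  apply: le_trans (graph_dist_ge 0 x x).
  by rewrite le_min coord_dist_ge0 invr_ge0 ler0n.
- move=> x y; rewrite /graph_dist; congr sup; apply: eq_imagel => i _.
  by rewrite coord_distC.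
- move=> x y z; apply: graph_dist_le => i.
  apply: le_trans (lerD (graph_dist_ge i x y) (graph_dist_ge i y z)).
  have := coord_dist_tri i x y z.
  have := coord_dist_ge0 i x y; have := coord_dist_ge0 i y z.
  have : 0 <= i.+1%:R^-1 :> R by rewrite invr_ge0 ler0n.
  move: (i.+1%:R^-1) => a; rewrite /Num.min; case: ltP => ?; case: ltP => ?; case: ltP => ? *; lra.
Qed.

Lemma coord_dist_lt i c x y : graph_dist x y < c -> c <= i.+1%:R^-1 ->
  coord_dist i x y < c.
Proof.
move=> h1 h2; have := le_lt_trans (graph_dist_ge i x y) h1.
by rewrite gt_min => /orP[/lt_le_trans/(_ h2)|//]; rewrite ltxx.
Qed.

Lemma graph_dist_le_lt N c x y : N.+1%:R^-1 <= c ->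
  (forall i, (i < N.+1)%N -> coord_dist i x y <= c) -> graph_dist x y <= c.
Proof.
move=> Nc H; apply: graph_dist_le => i; rewrite ge_min.
have [iN|Ni] := ltnP i N.+1; first by rewrite H ?orbT.
apply/orP; left; apply: le_trans Nc.
by rewrite lef_pV2 ?posrE// ler_nat ltnW.
Qed.

Lemma graph_dist_cvg (u : nat -> X) x :
  (forall c, 0 < c -> \forall n \near \oo, graph_dist x (u n) < c) <->
  (u n @[n --> \oo] --> x /\ forall i, e i (u n) @[n --> \oo] --> e i x).
Proof.
split=> [H|[/(metric_cvgP dX) ux uc] c c0].
  have Hi i c : 0 < c -> \forall n \near \oo, coord_dist i x (u n) < c.
    move=> c0; have m0 : 0 < Num.min c i.+1%:R^-1 by rewrite lt_min c0 invr_gt0/=.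
    apply: filterS (H _ m0) => n /coord_dist_lt h.
    by apply: lt_le_trans (h i _) _; rewrite ge_min lexx// orbT.
  split; first by apply/(metric_cvgP dX) => c; exact: Hi 0%N c.
  by move=> i; apply/cvgrPdist_lt => c; exact: Hi i.+1 c.
(* Half of [c], because [graph_dist_le_lt] yields only a weak inequality. *)
have c2 : 0 < c / 2 by rewrite divr_gt0.
have [N] := ltr_add_invr (y := 0) c2; rewrite add0r => Nc.
have := @near_forall_lt (fun i n => coord_dist i x (u n) < c / 2) N.+1.
case=> [[|i] _|M _ HM] /=; first exact: ux.
  by move/cvgrPdist_lt: (uc i); exact.
exists M => // n /HM h; apply: (@le_lt_trans _ _ (c / 2)); last by lra.
apply: (graph_dist_le_lt (ltW Nc)) => i /h; exact: ltW.
Qed.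

(** Each coordinate is Cauchy. Completeness of [d] gives the limit [x], and the closed graph
    identifies the other limits with the values at [x]. *)
Lemma graph_dist_complete (u : nat -> X) :
  (forall c, 0 < c -> exists N, forall m n,
     (N <= m)%N -> (N <= n)%N -> graph_dist (u m) (u n) < c) ->
  exists x, forall c, 0 < c -> \forall n \near \oo, graph_dist x (u n) < c.
Proof.
move=> H.
have Hi i c : 0 < c -> exists N, forall m n,
    (N <= m)%N -> (N <= n)%N -> coord_dist i (u m) (u n) < c.
  move=> c0; have m0 : 0 < Num.min c i.+1%:R^-1 by rewrite lt_min c0 invr_gt0/=.
  have [N HN] := H _ m0; exists N => m n Nm Nn.
  have /coord_dist_lt h := HN m n Nm Nn.
  by apply: lt_le_trans (h i _) _; rewrite ge_min lexx// orbT.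
have [x ux] := dcomplete (Hi 0%N); exists x; apply/graph_dist_cvg; split=> //.
apply: e_closed => // i; apply/cauchy_cvgP/cauchy_exP => c c0.
have [N HN] := Hi i.+1 c c0; exists (e i (u N)); exists N => // n Nn.
exact: HN.
Qed.

(** * The pulled-back topology *)

Definition graph_opens : set (set X) := [set U | forall x, U x ->
  exists2 c, 0 < c & [set y | graph_dist x y < c] `<=` U].

Lemma graph_opensT : graph_opens setT.
Proof. by move=> x _; exists 1. Qed.

Lemma graph_opensI : setI_closed graph_opens.
Proof.
move=> U V oU oV x [Ux Vx]; have [a a0 aU] := oU x Ux; have [b b0 bV] := oV x Vx.
exists (Num.min a b); first by rewrite lt_min a0.
by move=> y /=; rewrite lt_min => /andP[/aU + /bV].
Qed.

Lemma graph_opens_bigcup (I : Type) (F : I -> set X) :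
  (forall i, graph_opens (F i)) -> graph_opens (\bigcup_i F i).
Proof.
move=> oF x [i _ Fx]; have [a a0 aF] := oF i x Fx.
by exists a => // y /aF Fy; exists i.
Qed.

Definition graph_topology : topology X :=
  Topology graph_opensT graph_opensI graph_opens_bigcup.

Lemma graph_metrizes : @metrizes R (with_topology graph_topology) graph_dist.
Proof.
have [g0 gxx gC gt] := graph_dist_metric.
move=> x A; rewrite nbhsE; split=> [[U [oU Ux] UA]|[c c0 cA]].
  have [c c0 cU] : exists2 c, 0 < c & [set y | graph_dist x y < c] `<=` U.
    exact: oU.
  by exists c => // y /cU/UA.
exists [set y | graph_dist x y < c] => //; split; last by rewrite /= (gxx x x).2.
move=> y /= xy; exists (c - graph_dist x y); first by rewrite subr_gt0.
by move=> z /= yz; apply: le_lt_trans (gt _ y _) _; rewrite -ltrBrDl.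
Qed.

Lemma seq_open_graph A : seq_open_in (range e) A -> opens graph_topology A.
Proof.
move=> oA x Ax; apply: contrapT => H.
have /choice[u uP] n : exists y, graph_dist x y < n.+1%:R^-1 /\ ~ A y.
  apply: contrapT => H'; apply: H; exists n.+1%:R^-1; first by rewrite invr_gt0.
  by move=> y xy; apply: contrapT => Ay; apply: H'; exists y.
have [ux ue] : u n @[n --> \oo] --> x /\ forall i, e i (u n) @[n --> \oo] --> e i x.
  apply/graph_dist_cvg => c c0.
  have [N] := ltr_add_invr (y := 0) c0; rewrite add0r => Nc.
  exists N => // n /= Nn; apply: lt_trans (uP n).1 _; apply: le_lt_trans Nc.
  by rewrite lef_pV2 ?posrE// ler_nat.
have [|N _ HN] := oA u x Ax ux; first by move=> _ [i _ <-].
by apply: (uP N).2; apply: HN => /=.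
Qed.

Lemma graph_topology_finer U : open U -> opens graph_topology U.
Proof.
move=> oU; apply: seq_open_graph => u x Ux ux _.
by apply: ux; apply: open_nbhs_nbhs.
Qed.

(** * Countably many cells: separability and Borel complexity *)

Variable s : nat -> X.
Hypothesis s_dense : forall x c, 0 < c -> exists j, d (s j) x < c.

Definition cell (k : nat * nat * seq rat) : set X :=
  let: (N, j, q) := k in
  [set x | d (s j) x < N.+1%:R^-1] `&`
  [set x | forall i, (i < N)%N -> `|ratr (nth 0 q i) - e i x| < N.+1%:R^-1].

Lemma small_cell x c : 0 < c -> exists k, cell k x /\
  forall y z, cell k y -> cell k z -> graph_dist y z < c.
Proof.
move=> c0; have c2 : 0 < c / 3 by rewrite divr_gt0.
have [N] := ltr_add_invr (y := 0) c2; rewrite add0r; set a := N.+1%:R^-1 => Nc.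
have a0 : 0 < a by rewrite invr_gt0.
have [j sj] := s_dense x a0.
have /choice[q hq] i : exists r : rat, `|ratr r - e i x| < a.
  have /rat_in_itvoo[r] : e i x - a < e i x + a by lra.
  rewrite in_itv/= => /andP[h1 h2]; exists r.
  by rewrite ltr_norml; apply/andP; split; lra.
exists (N, j, mkseq q N); split.
  by split=> // i iN; rewrite nth_mkseq.
case: (dm) => _ _ dC dt.
(* Two points of a cell are less than [2a] apart in [d] and in the first [N] functions; the other
   coordinates are truncated below [a]. *)
move=> y z [/= sy qy] [/= sz qz]; apply: (@le_lt_trans _ _ (a + a)); last by lra.
apply: (@graph_dist_le_lt N); first by rewrite -/a; lra.
case=> [_|i]; last rewrite ltnS => iN.
  apply: le_trans (dt _ (s j) _) _; rewrite (dC y).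
  by apply: lerD; exact: ltW.
apply: le_trans (ler_distD (ratr (nth 0 (mkseq q N) i)) _ _) _.
by rewrite (distrC (e i y)); apply: lerD; apply: ltW; [exact: qy|exact: qz].
Qed.

Lemma graph_polish : polish R (with_topology graph_topology).
Proof.
split; last first.
  exists graph_dist; split; first exact: graph_dist_metric.
    exact: graph_metrizes.
  move=> u /graph_dist_complete[x ux]; exists x.
  exact/(metric_cvgP graph_metrizes).
have /choice[p hp] k : exists y, (exists x, cell k x) -> cell k y.
  by have [[x kx]|h] := pselect (exists x, cell k x); [exists x|exists x0].
exists (\bigcup_k [set p k]); first by apply: bigcup_countable.
move=> O [x Ox] /(metric_openP graph_metrizes)/(_ x Ox)[c c0 cO].
have [k [kx ksmall]] := small_cell x c0; exists (p k); split; last by exists k.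
by apply: cO; apply: ksmall => //; apply: hp; exists x.
Qed.

(** An open set is the union of the countably many cells it contains, and each cell is a finite
    intersection of sets at level [xi]. *)
Lemma graph_opens_Sigma0 xi U : ole oone xi ->
  (forall i V, open V -> Sigma0 xi (e i @^-1` V)) ->
  opens graph_topology U -> Sigma0 xi U.
Proof.
move=> xi1 He oU.
have -> : U = \bigcup_(k in [set k | cell k `<=` U]) cell k.
  apply/seteqP; split=> [x Ux|x [k /= kU /kU//]].
  have [c c0 cU] := oU x Ux; have [k [kx ksmall]] := small_cell x c0.
  by exists k => // y ky; apply: cU; exact: ksmall.
apply: (Sigma0_bigcup_countable dm dX) => // -[[N j] q] _.
apply: (Sigma0_setI dm dX).
  by apply: (open_Sigma0 dm dX) => //; exact: metric_open_ball.
apply: (Sigma0_bigcap_lt dm dX xi1 (A := fun i =>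
  [set x | `|ratr (nth 0 q i) - e i x| < N.+1%:R^-1])) => i _.
apply: (He i [set y | `|ratr (nth 0 q i) - y| < N.+1%:R^-1]).
rewrite (_ : mkset _ = ball (ratr (nth 0 q i) : R) N.+1%:R^-1)//.
by apply: ball_open; rewrite invr_gt0.
Qed.

End Refinement.

(** * Comparison of the two ranks *)

(** Kuratowski's refinement theorem, obtained by pulling back the product topology along functions
    that open the given sets. *)
Lemma Sigma0_refinement (R : realType) (X : topologicalType) (x0 : X)
    (I : countType) xi (A : I -> set X) :
  polish R X -> ole oone xi -> (forall i, Sigma0 xi (A i)) ->
  exists tau : topology X, [/\ polish R (with_topology tau),
    forall U : set X, open U -> opens tau U,
    forall U : set X, opens tau U -> Sigma0 xi U &
    forall i, opens tau (A i)].
Proof.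
move=> [[S Sc Sd] [d [dm dX dcomplete]]] xi1 hA.
have [Phi [Pc Pg PS Po]] := Sigma0_opening dm dX hA.
have [e [ePhi Phie]] := countable_enum (fun=> 0) Pc.
have [s [sS _]] := countable_enum x0 Sc.
have s_dense x c : 0 < c -> exists j, d (s j) x < c.
  move=> c0; have [|y [/= xy Sy]] := Sd _ _ (metric_open_ball dm dX x c).
    by exists x; case: dm => _ dxx _ _; rewrite /= (dxx x x).2.
  have [j sj] := sS y Sy; exists j; rewrite sj.
  by case: dm => _ _ dC _; rewrite dC.
have e_closed (u : nat -> X) x : u n @[n --> \oo] --> x ->
    (forall i, cvg (e i (u n) @[n --> \oo])) ->
    forall i, e i (u n) @[n --> \oo] --> e i x.
  move=> ux uc i; case: (Phie i) => [Pe|->]; last exact: cvg_cst.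
  by apply: (Pg u x ux) => // phi /ePhi[n <-].
exists (graph_topology d e); split.
- exact: (graph_polish dm dX dcomplete x0 e_closed s_dense).
- move=> U; exact: graph_topology_finer.
- move=> U; apply: (graph_opens_Sigma0 dm dX s_dense xi1) => i V oV.
  case: (Phie i) => [Pe|->]; first exact: PS.
  have [V0|V0] := pselect (V 0).
    rewrite (_ : _ @^-1` V = setT); last by apply/seteqP; split.
    by apply: (open_Sigma0 dm dX) => //; exact: openT.
  rewrite (_ : _ @^-1` V = set0); last by rewrite -subset0 => y.
  by apply: (open_Sigma0 dm dX) => //; exact: open0.
- move=> i; apply: (seq_open_graph dX) => u x Ax ux H.
  by apply: (Po i u x Ax ux) => phi /ePhi[n <-]; apply: H; exists n.
Qed.

Lemma Baire_class_inv (R : realType) (X : topologicalType) xi (f : X -> R) :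
  Baire_class xi f ->
  oeq xi OZ \/ exists eta (g : nat -> X -> R),
    [/\ forall n, olt (eta n) xi, forall n, Baire_class (eta n) (g n) &
        forall x, g n x @[n --> \oo] --> f x].
Proof. by case=> [{}xi h e _|{}xi eta g h *]; [left|right; exists eta, g]. Qed.

Lemma alpha_star_le (R : realType) (X : topologicalType) xi (f : X -> R) :
  polish R X -> [set: X] !=set0 -> ole oone xi -> Baire_class xi f ->
  xle (alpha_star xi f) (alpha_xi xi f).
Proof.
move=> PX [x0 _] xi1 Bf; have [_ [d [dm dX _]]] := PX.
case E : (alpha_xi xi f) => [lam|]; last by case: alpha_star.
have xi0 : ~ ole xi OZ by move=> h; apply: (oltOZ (ole_trans xi1 h)).
have [eta [g [heta hg gf]]] : exists eta (g : nat -> X -> R),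
    [/\ forall n, olt (eta n) xi, forall n, Baire_class (eta n) (g n) &
        forall x, g n x @[n --> \oo] --> f x].
  case/Baire_class_inv: Bf => [[h _]|[eta [g H]]]; first by case: xi0.
  by exists eta, g.
have lamP : xle (alpha_xi xi f) (Ctbl lam) by rewrite E.
pose D (p q : rat) (F : ord -> set X) l := [/\ continuous_decreasing F l,
  forall a, olt a l -> Pi0 xi (F a),
  sublevel f p `<=` transfinite_difference F l &
  transfinite_difference F l `<=` ~` superlevel f q].
have HF (pq : rat * rat) : exists Fl : (ord -> set X) * ord * (nat -> ord),
    pq.1 < pq.2 -> [/\ D pq.1 pq.2 Fl.1.1 Fl.1.2, ole Fl.1.2 lam &
    forall b, olt b Fl.1.2 -> exists n, oeq b (Fl.2 n)].
  case: pq => p q /=.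
  have [pq|npq] := boolP (p < q); last by exists (fun=> set0, OZ, fun=> OZ).
  have : xle (alpha_sets xi (sublevel f p) (superlevel f q)) (Ctbl lam).
    by apply: (xsup_ub lamP); exists p, q.
  move=> /xle_Ctbl[l /least_Ctbl[[F DF] _] ll].
  by have [e he] := enum_below l; exists (F, l, e).
have {HF}[Fl HFl] := choice HF.
(* Opening the preimages of rational intervals makes every [g n] continuous; opening the complements
   makes the terms of the chosen sequences closed. *)
pose A (i : (nat * rat * rat) + (rat * rat * nat)) : set X := match i with
  | inl (n, a, b) => g n @^-1` `]ratr a, ratr b[%classic
  | inr (p, q, n) =>
    if p < q then ~` (Fl (p, q)).1.1 ((Fl (p, q)).2 n) else set0
  end.
have hA i : Sigma0 xi (A i).
  case: i => [[[n a] b]|[[p q] n]] /=.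
    by apply: (Sigma0_le dm dX (heta n)); apply: (Baire_class_Sigma0 dm dX (hg n)); exact: itv_open.
  case: ifPn => pq; last by apply: (open_Sigma0 dm dX) => //; exact: open0.
  have [[cd Pi _ _] _ _] := HFl (p, q) pq.
  (* The enumeration may pass the length of the sequence, where the terms are empty. *)
  have [h|h] := ole_or_lt (Fl (p, q)).1.2 ((Fl (p, q)).2 n); last exact: Pi.
  have [_ _ _ _ ->//] := cd.
  by rewrite setC0; apply: (open_Sigma0 dm dX) => //; exact: openT.
have [tau [ptau tauX tauS tauA]] := Sigma0_refinement x0 PX xi1 hA.
have gc n : @Baire_class (with_topology tau) R OZ (g n).
  apply: Baire_class0; first exact: oeq_refl.
  move=> x V /= /nbhs_ballP[c /= c0 cV].
  have /rat_in_itvoo[a] : g n x - c < g n x by rewrite gtrBl.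
  rewrite in_itv/= => /andP[a1 a2].
  have /rat_in_itvoo[b] : g n x < g n x + c by rewrite ltrDl.
  rewrite in_itv/= => /andP[b1 b2].
  exists (A (inl (n, a, b))); split=> //.
  - exact: tauA (inl (n, a, b)).
  - by rewrite /A /= in_itv/= a2 b1.
  - move=> y; rewrite /A /= in_itv/= => /andP[h1 h2]; apply: cV.
    by rewrite /ball/= ltr_norml; apply/andP; split; lra.
have Ttau : T_set f xi tau.
  split=> //; apply: (@Baire_class_lim (with_topology tau) R _ (fun=> OZ) g) => // n; exact: olt_succ.
have le_top : xle (@alpha_top (with_topology tau) R f) (Ctbl lam).
  apply: xsup_le => _ [p [q [pq ->]]]; have [[cd Pi AH HB] ll en] := HFl (p, q) pq.
  apply: xle_trans (least_le (a := (Fl (p, q)).1.2) _) _; last exact: ll.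
  (* In the refined topology the iterate at the length of the sequence lies in the term there, which
     is empty. *)
  rewrite /= -subset0 => x xl.
  have [_ _ _ _ Fe] := cd; rewrite -(Fe _ (ole_refl _)).
  apply: (@iter_derivative_sub_difference (with_topology tau) _ _ _ _ cd _ AH HB _ _ xl).
  move=> a; rewrite -openC.
  have [h|/en[n na]] := ole_or_lt (Fl (p, q)).1.2 a.
    by rewrite (Fe _ h) setC0; exact: openT.
  have -> : (Fl (p, q)).1.1 a = (Fl (p, q)).1.1 ((Fl (p, q)).2 n).
    by case: cd na => Fanti _ _ _ _ [h1 h2]; apply/seteqP; split; exact: Fanti.
  by have := tauA (inr (p, q, n)); rewrite /= pq.
have [a ea al] := xle_Ctbl le_top.
apply: (@xle_trans (Ctbl a)) => //.
by apply: least_le; exists tau.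
Qed.

(** A countable [alpha_star] is attained by some [tau]. The interleaved sequence computed in [tau]
    has closed terms there, hence [Pi0 xi] terms in [X], and the length [2* mu] serves all pairs
    [p < q]. *)
Lemma alpha_xi_le (R : realType) (X : topologicalType) xi (f : X -> R) :
  xle (alpha_xi xi f) (xdouble (alpha_star xi f)).
Proof.
case E : (alpha_star xi f) => [mu|]; last by case: alpha_xi.
have [[tau [_ _ tauS _] Emu] _] := least_Ctbl E.
have muP : xle (@alpha_top (with_topology tau) R f) (Ctbl mu) by rewrite -Emu.
apply: xsup_le => _ [p [q [pq ->]]].
have : xle (rk (@derivative_sep (with_topology tau) (sublevel f p)
    (superlevel f q))) (Ctbl mu).
  by apply: (xsup_ub muP); exists p, q.
move=> /xle_Ctbl[b /least_Ctbl[b0 _] bmu].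
have mu0 : iter_derivative (@derivative_sep (with_topology tau) (sublevel f p)
    (superlevel f q)) mu = set0.
  by rewrite -subset0 -b0; exact: iter_derivative_anti.
apply: least_le.
exists (@interleave (with_topology tau) (sublevel f p) (superlevel f q)); split.
- exact: (interleave_continuous mu0).
- move=> a _; apply: tauS.
  exact: (closed_openC (@closed_interleave (with_topology tau) _ _ a)).
- exact: (interleave_difference_sup mu0).
- exact: (@interleave_difference_sub (with_topology tau)).
Qed.

Theorem theorem5p17 (R : realType) (X : topologicalType) (xi : ord)
    (f : X -> R) :
  polish R X ->
  ~ countable [set: X]%classic ->
  ole oone xi ->
  Baire_class xi f ->
  [/\ xle (alpha_star xi f) (alpha_xi xi f),
      xle (alpha_xi xi f) (xdouble (alpha_star xi f)) &
      xapprox (alpha_star xi f) (alpha_xi xi f)].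
Proof.
move=> PX Xunc xi1 Bf.
have X0 : [set: X] !=set0.
  by apply/set0P/eqP => X0; apply: Xunc; rewrite X0.
have h1 := alpha_star_le PX X0 xi1 Bf.
have h2 := alpha_xi_le xi f.
split=> //; split=> eta eta1; first exact: xle_trans.
(* The factor two is absorbed by [omega_pow eta], as [eta] is at least one. *)
move=> /xle_Ctbl[b e be]; apply: xle_trans h2 _; rewrite e.
exact: ole_trans (dbl_le be) (dbl_omega_pow eta1).
Qed.
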